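(* Let $c=v=2$, let $W_\infty\in\mathcal W_2$ satisfy $\int_0^1W_\infty(x,y)\,dy=1$ for Lebesgue-a.e. $x$ and $W_\infty>0$ Lebesgue-a.e., let $\mu(\{1\})=p\in(0,1)$, $\mu(\{2\})=1-p$, and let $\boldsymbol\alpha=(\theta,-\theta)$ for some $\theta\in\mathbb R$. Let $\boldsymbol h=(h_1,h_2)\in\mathbb R^2$ be such that $\mu(\{r\})=e^{h_r}/(e^{h_1}+e^{h_2})$ for $r=1,2$. (i) The maximizer of $$\sup_{\boldsymbol f\in\mathcal F_2}\left\{\theta G_{W_\infty,\mathbf 1_1}(\boldsymbol f)-\theta G_{W_\infty,\mathbf 1_2}(\boldsymbol f)+\sum_{r=1}^2h_r\int_0^1f_r(u)\,du-\int_0^1\sum_{r=1}^2f_r(u)\log f_r(u)\,du\right\}-\log2$$ is Lebesgue-a.e. equal to $\left(\frac{p\exp(2\theta)}{1-p+p\exp(2\theta)},\frac{1-p}{1-p+p\exp(2\theta)}\right)$, and hence it is unique. (ii) For $y\in(-1,1)$, $$I_{W_\infty,(1,-1)}(y)=\Big(\frac{y+1}2\Big)\log\Big(\frac{y+1}{2p}\Big)+\Big(\frac{1-y}2\Big)\log\Big(\frac{1-y}{2(1-p)}\Big).$$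
   Context: $\mathcal W_2$ is the space of symmetric real-valued functions in $L^1([0,1]^2)$. $\mathcal F_2$ is the set of measurable $\boldsymbol f=(f_1,f_2):[0,1]\to[0,1]^2$ with $f_1(x)+f_2(x)=1$ for all $x$ (modulo a.e. equality). For $W\in\mathcal W_2$, $G_{W,\mathbf 1_r}(\boldsymbol f):=\int_{[0,1]^2}W(x_1,x_2)f_r(x_1)f_r(x_2)\,dx_1dx_2$. For $(a_1,a_2)\in\mathbb R^2$, $$I_{W_\infty,(a_1,a_2)}(t):=\inf_{\boldsymbol f\in\mathcal F_2:\ a_1G_{W_\infty,\mathbf 1_1}(\boldsymbol f)+a_2G_{W_\infty,\mathbf 1_2}(\boldsymbol f)=t}\left\{\int_0^1\sum_{r=1}^2 f_r(u)\log f_r(u)\,du-\sum_{r=1}^2h_r\int_0^1f_r(u)\,du\right\}+\log(e^{h_1}+e^{h_2}).$$ Conventions: $0\log0=0$, $\inf\emptyset=+\infty$. *)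

(* Defs.v *)
From HB Require Import structures.
From mathcomp Require Import all_boot all_order all_algebra.
From mathcomp Require Import all_classical all_reals all_analysis.

Set Implicit Arguments.
Unset Strict Implicit.
Unset Printing Implicit Defensive.

Import Order.TTheory GRing.Theory Num.Theory.
Import numFieldNormedType.Exports.

Local Open Scope classical_set_scope.
Local Open Scope ring_scope.

(* The colours 1, 2 are the two elements ord0, ord_max of 'I_2.  Functions on
   [0,1] (resp. [0,1]^2) are represented by functions on R (resp. R * R) whose
   values outside [0,1] (resp. [0,1]^2) are irrelevant. *)

Definition vec2 (R : realType) (x y : R) : 'I_2 -> R :=
  fun r => if r == ord0 then x else y.

Definition unitI (R : realType) : set R := `[0, 1].
Arguments unitI R : clear implicits.
Definition unitSq (R : realType) : set (R * R) := unitI R `*` unitI R.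
Arguments unitSq R : clear implicits.

Notation leb R := (@lebesgue_measure R).
Notation leb2 R := (@lebesgue_measure R \x @lebesgue_measure R)%E.

(* Symmetry is required almost everywhere, as L^1 is taken modulo null sets. *)
Definition kernelW2 (R : realType) (W : R * R -> R) : Prop :=
  (leb2 R).-integrable (unitSq R) (EFin \o W) /\
  {ae leb2 R, forall z, unitSq R z -> W (z.1, z.2) = W (z.2, z.1)}.

Definition F2 (R : realType) (f : 'I_2 -> R -> R) : Prop :=
  [/\ forall r, measurable_fun (unitI R) (f r),
      forall r x, unitI R x -> 0 <= f r x <= 1 &
      forall x, unitI R x -> \sum_(r < 2) f r x = 1].

Definition aeeq (R : realType) (f g : 'I_2 -> R -> R) : Prop :=
  {ae leb R, forall x, unitI R x -> forall r, f r x = g r x}.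

Definition G (R : realType) (W : R * R -> R) (r : 'I_2) (f : 'I_2 -> R -> R) : R :=
  \int[leb2 R]_(z in unitSq R) (W z * f r z.1 * f r z.2).

(* Library convention: ln 0 = 0, so the integrand is 0 where f r vanishes. *)
Definition entropy (R : realType) (f : 'I_2 -> R -> R) : R :=
  \int[leb R]_(u in unitI R) (\sum_(r < 2) f r u * ln (f r u)).

Definition field_term (R : realType) (h : 'I_2 -> R) (f : 'I_2 -> R -> R) : R :=
  \sum_(r < 2) h r * \int[leb R]_(u in unitI R) f r u.

Definition rateI (R : realType) (W : R * R -> R) (h a : 'I_2 -> R) (t : R) :
    \bar R :=
  (ereal_inf [set (entropy f - field_term h f)%:E
             | f in [set f | F2 f /\ (\sum_(r < 2) a r * G W r f)%R = t]]
   + (ln (\sum_(r < 2) expR (h r)))%:E)%E.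

Definition objective (R : realType) (W : R * R -> R) (h alpha : 'I_2 -> R)
    (f : 'I_2 -> R -> R) : R :=
  \sum_(r < 2) alpha r * G W r f + field_term h f - entropy f.

Definition sup_value (R : realType) (W : R * R -> R) (h alpha : 'I_2 -> R) :
    \bar R :=
  (ereal_sup [set (objective W h alpha f)%:E | f in [set f | F2 f]]
   - (ln 2)%:E)%E.

Definition is_maximizer (R : realType) (W : R * R -> R) (h alpha : 'I_2 -> R)
    (f : 'I_2 -> R -> R) : Prop :=
  F2 f /\ (objective W h alpha f - ln 2)%:E = sup_value W h alpha.

(* Main.v *)
(* Writing f_1(x) f_1(y) - f_2(x) f_2(y) = f_1(x) - f_2(y) and integrating
   against W, the degree condition (with symmetry, for the second term) gives
   G_1(f) - G_2(f) = int f_1 - int f_2: the quadratic functional is linear.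
   Both parts then follow from Gibbs' inequality
   sum_r ln(q_r) int f_r <= entropy f, with equality iff f = q a.e., for a
   constant probability vector q: the tilted prior in (i), and
   ((1 + y)/2, (1 - y)/2) in (ii). *)

Require Import Defs.
From HB Require Import structures.
From mathcomp Require Import all_boot all_order all_algebra.
From mathcomp Require Import all_classical all_reals all_analysis.
From mathcomp Require Import unstable measurable_realfun ring lra.

Set Implicit Arguments.
Unset Strict Implicit.
Unset Printing Implicit Defensive.

Import Order.TTheory GRing.Theory Num.Theory.
Import numFieldNormedType.Exports.

Local Open Scope classical_set_scope.
Local Open Scope ring_scope.

(** * Two-colour bookkeeping and the scalar inequality behind Gibbs *)

Lemma sum_ord2 (V : nmodType) (F : 'I_2 -> V) :
  \sum_(r < 2) F r = F ord0 + F ord_max.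
Proof. by rewrite big_ord_recl big_ord1; congr (_ + F _); exact: val_inj. Qed.

Lemma forall_ord2 (P : 'I_2 -> Prop) : P ord0 -> P ord_max -> forall r, P r.
Proof.
move=> P0 P1 r; have [->//|] := eqVneq r ord0.
case: r => -[//|[|//]] i _.
by rewrite (_ : Ordinal i = ord_max)//; exact: val_inj.
Qed.

(** For [s > 0] and [s != q] this is [1 + x < expR x] at the nonzero point [x = ln q - ln s],
    multiplied by [s]. At [s = 0] the right side is 0 and the inequality is strict. *)
Lemma mulr_ln_gap (R : realType) (s q : R) : 0 <= s -> 0 < q ->
  s - q <= s * ln s - s * ln q ?= iff (s == q).
Proof.
rewrite le_eqVlt => /predU1P[<- q0|s0 q0].
  apply/leifP; rewrite (lt_eqF q0); lra.
apply/leifP; have [->|sq] := eqVneq s q; first by rewrite !subrr.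
have t0 : ln q - ln s != 0.
  by rewrite subr_eq0 (inj_in_eq (@ln_inj R)) ?posrE// eq_sym.
have := expR_gt1Dx t0; rewrite expRD expRN !lnK ?posrE// => h.
have := h; rewrite -(ltr_pM2l s0) mulrCA mulfV ?gt_eqF// mulr1.
by nra.
Qed.

(** The gap at [q = 1] gives [s - 1 <= s * ln s], and [ln s <= 0] bounds it above. This makes
    entropy integrands integrable. *)
Lemma mulr_ln_norm_le1 (R : realType) (s : R) : 0 <= s <= 1 -> `|s * ln s| <= 1.
Proof.
move=> /andP[s0 s1]; have [h _] := mulr_ln_gap s0 (ltr01 : 0 < 1 :> R).
rewrite ln1 mulr0 subr0 in h.
have := mulr_ge0_le0 s0 (ln_le0 s1) => h'.
by rewrite ler_norml; lra.
Qed.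

(** * Gibbs' inequality on the unit interval, with its equality case *)

Section unit_interval.
Context (R : realType).
Implicit Types (f : 'I_2 -> R -> R) (q : 'I_2 -> R).

(* R carries two convertible measurable structures with different displays;
   lebesgue_measure lives on the one of measurableTypeR. *)
Lemma measurable_unitI : measurable (unitI R : set (measurableTypeR R)).
Proof. exact: measurable_itv. Qed.

Lemma lebesgue_unitI : leb R (unitI R) = 1%E.
Proof. by rewrite /unitI lebesgue_measure_itv/= lte_fin ltr01 -EFinB subr0. Qed.

Lemma bounded_integrable_unitI (g : R -> R) (M : R) :
  measurable_fun (unitI R) g -> (forall x, unitI R x -> `|g x| <= M) ->
  (leb R).-integrable (unitI R) (EFin \o g).
Proof.
move=> mg gM; apply: measurable_bounded_integrable => //.
- exact: measurable_unitI.
- by rewrite [ltLHS]lebesgue_unitI ltry.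
- exists M; split => [|y My x /= xI]; first exact: num_real.
  exact: (le_trans (gM _ xI) (ltW My)).
Qed.

Lemma F2_norm_le1 f r x : F2 f -> unitI R x -> `|f r x| <= 1.
Proof. by move=> [_ f01 _] /(f01 r)/andP[f0 f1]; rewrite ger0_norm. Qed.

Lemma F2_integrable f r : F2 f -> (leb R).-integrable (unitI R) (EFin \o f r).
Proof.
move=> Ff; apply: (@bounded_integrable_unitI _ 1) => [|x]; first by case: Ff.
exact: F2_norm_le1.
Qed.

Lemma measurable_mulr_ln (g : R -> R) : measurable_fun (unitI R) g ->
  measurable_fun (unitI R) (fun x => g x * ln (g x)).
Proof.
move=> mg; apply: measurable_funM => //.
by apply: measurableT_comp mg; exact: measurable_ln.
Qed.

Lemma F2_integrable_mulr_ln f r : F2 f ->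
  (leb R).-integrable (unitI R) (EFin \o (fun x => f r x * ln (f r x))).
Proof.
move=> [mf f01 _]; apply: (@bounded_integrable_unitI _ 1) => [|x xI].
  exact: measurable_mulr_ln.
exact/mulr_ln_norm_le1/f01.
Qed.

Lemma Rintegral_unitI_cst (c : R) : \int[leb R]_(_ in unitI R) c = c.
Proof.
rewrite Rintegral_cst ?[X in fine X]lebesgue_unitI ?mulr1//.
exact: measurable_unitI.
Qed.

Lemma Rintegral_sum (I : finType) (g : I -> R -> R) :
  (forall i, (leb R).-integrable (unitI R) (EFin \o g i)) ->
  \int[leb R]_(x in unitI R) (\sum_i g i x) =
  \sum_i \int[leb R]_(x in unitI R) g i x.
Proof.
move=> gi; rewrite /Rintegral.
under eq_integral do rewrite -sumEFin.
rewrite integral_sum//; last exact: measurable_unitI.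
rewrite -sum_fine// => i _; apply: integrable_fin_num (gi i).
exact: measurable_unitI.
Qed.

Lemma F2_sum_Rintegral f : F2 f ->
  \sum_(r < 2) \int[leb R]_(x in unitI R) f r x = 1.
Proof.
move=> Ff; rewrite -Rintegral_sum => [|r]; last exact: F2_integrable.
rewrite -[RHS]Rintegral_unitI_cst; apply: eq_Rintegral => x /set_mem xI.
by case: Ff => _ _ /(_ _ xI).
Qed.

(** The colour masses add up to 1; normalising constants are extracted from a field this way. *)
Lemma field_term_cst (c : R) f : F2 f -> field_term (fun=> c) f = c.
Proof.
by move=> Ff; rewrite /field_term -mulr_sumr F2_sum_Rintegral ?mulr1. Qed.

Lemma field_termD (h1 h2 : 'I_2 -> R) f :
  field_term (fun r => h1 r + h2 r) f = field_term h1 f + field_term h2 f.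
Proof.
by rewrite /field_term -big_split; apply: eq_bigr => r _; rewrite mulrDl. Qed.

(** Strict positivity keeps every [ln (q r)] a genuine logarithm, as [mulr_ln_gap] requires. *)
Definition prob_vec q := (forall r, 0 < q r) /\ \sum_(r < 2) q r = 1.

Lemma F2_cst q : prob_vec q -> F2 (fun r _ => q r).
Proof.
move=> [q0 q1]; split => // r x _; rewrite ltW//= -q1.
by rewrite (bigD1 r)//= lerDl sumr_ge0// => i _; exact/ltW.
Qed.

Lemma entropy_cst q :
  entropy (fun r _ => q r) = field_term (fun r => ln (q r)) (fun r _ => q r).
Proof.
rewrite /entropy /field_term Rintegral_unitI_cst; apply: eq_bigr => r _.
by rewrite Rintegral_unitI_cst mulrC.
Qed.

(** Pointwise relative entropy (Kullback-Leibler divergence) of [f] at [x] with respect to [q]. *)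
Definition kl_integrand f q (x : R) :=
  \sum_(r < 2) (f r x * ln (f r x) - f r x * ln (q r)).

(** In the sum of [mulr_ln_gap] over colours, the lower bounds [f r x - q r] cancel because both
    vectors sum to 1; equality in the sum forces equality for each colour. *)
Lemma kl_integrand_ge0 f q x : F2 f -> prob_vec q -> unitI R x ->
  0 <= kl_integrand f q x ?= iff [forall r, f r x == q r].
Proof.
move=> [_ f01 f1] [q0 q1] xI.
have -> : 0 = \sum_(r < 2) (f r x - q r) by rewrite sumrB q1 f1// subrr.
apply: leif_sum => r _; apply: mulr_ln_gap (q0 r).
by have /andP[] := f01 r x xI.
Qed.

Lemma kl_term_integrable f r c : F2 f ->
  (leb R).-integrable (unitI R)
    (EFin \o (fun x => f r x * ln (f r x) - f r x * c)).
Proof.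
move=> Ff; have mI := measurable_unitI.
have fi := F2_integrable r Ff; have li := F2_integrable_mulr_ln r Ff.
by have := integrableB mI li (integrableZr mI c fi); apply: eq_integrable.
Qed.

Lemma Rintegral_kl_integrand f q : F2 f ->
  \int[leb R]_(x in unitI R) kl_integrand f q x =
  entropy f - field_term (fun r => ln (q r)) f.
Proof.
move=> Ff; have mI := measurable_unitI.
rewrite Rintegral_sum => [|r]; last exact: kl_term_integrable.
rewrite /entropy Rintegral_sum => [|r]; last exact: F2_integrable_mulr_ln.
rewrite /field_term -sumrB; apply: eq_bigr => r _.
have fi := F2_integrable r Ff.
rewrite RintegralB//; last 2 first.
- exact: F2_integrable_mulr_ln.
- rewrite /comp; under eq_fun do rewrite EFinM; exact: (integrableZr mI).
by rewrite RintegralZr// [ln _ * _]mulrC.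
Qed.

Lemma gibbs_le f q : F2 f -> prob_vec q ->
  field_term (fun r => ln (q r)) f <= entropy f.
Proof.
move=> Ff qP; rewrite -subr_ge0 -Rintegral_kl_integrand//.
by apply: Rintegral_ge0 => x xI; have [] := kl_integrand_ge0 Ff qP xI.
Qed.

(** The relative entropy is a nonnegative integrand with zero integral, hence vanishes almost
    everywhere, where the pointwise equality case applies. *)
Lemma gibbs_eq f q : F2 f -> prob_vec q ->
  field_term (fun r => ln (q r)) f = entropy f -> aeeq f (fun r _ => q r).
Proof.
move=> Ff qP fq; have mI := measurable_unitI.
have ki : (leb R).-integrable (unitI R) (EFin \o kl_integrand f q).
  rewrite /comp /kl_integrand; under eq_fun do rewrite -sumEFin.
  by apply: integrable_sum => //= r _; exact: kl_term_integrable.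
have mk := measurable_int _ ki.
have : ae_eq (leb R) (unitI R) (EFin \o kl_integrand f q) (cst 0%E).
  apply/(ae_eq_integral_abs _ mI mk).
  under eq_integral => x /set_mem xI.
    rewrite gee0_abs/=;
      last by rewrite lee_fin; have [] := kl_integrand_ge0 Ff qP xI.
    over.
  rewrite -[LHS]fineK; last exact: integrable_fin_num ki.
  congr EFin; rewrite -[RHS](subrr (entropy f)) -{2}fq.
  exact: (Rintegral_kl_integrand q Ff).
apply: filterS => x kx0 xI r; have /= [k0] := kx0 xI.
have [_] := kl_integrand_ge0 Ff qP xI.
by rewrite k0 eqxx => /esym/forallP/(_ r)/eqP.
Qed.

End unit_interval.

(** * Exchange of coordinates in integrals over a product *)

Section product_swap.
Context d (T : measurableType d) (R : realType).
Variable mu : {sigma_finite_measure set T -> \bar R}.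
Implicit Types f : T * T -> \bar R.
Local Open Scope ereal_scope.

(** Tonelli in opposite orders: the two iterated integrals, of [abse \o (f \o swap)] and of
    [abse \o f], are then the same expression. *)
Lemma integrable_swap f : (mu \x mu).-integrable setT f ->
  (mu \x mu).-integrable setT (f \o swap).
Proof.
move=> /integrableP[mf foo].
have mfs : measurable_fun setT (f \o swap).
  by apply: measurableT_comp => //; exact: measurable_swap.
apply/integrableP; split => //.
rewrite (fubini_tonelli2 (abse \o (f \o swap))); last 2 first.
- exact: measurableT_comp mfs.
- by move=> z; exact: abse_ge0.
rewrite (fubini_tonelli1 (abse \o f)) in foo => //.
- exact: measurableT_comp mf.
- by move=> z; exact: abse_ge0.
Qed.

Lemma integral_swap f : (mu \x mu).-integrable setT f ->
  \int[mu \x mu]_z f (swap z) = \int[mu \x mu]_z f z.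
Proof.
move=> fi; rewrite -(integral21_prod_meas1 (integrable_swap fi)).
by rewrite -(integral12_prod_meas1 fi).
Qed.

End product_swap.

(** * Linearisation of the difference of the kernel functionals *)

Section kernel.
Context (R : realType) (W : R * R -> R).
Implicit Types (f : 'I_2 -> R -> R) (g : R -> R) (u : R * R -> R).
Hypothesis WL1 : (leb2 R).-integrable (unitSq R) (EFin \o W).

Lemma measurable_unitSq :
  measurable (unitSq R : set (measurableTypeR R * measurableTypeR R)).
Proof. by apply: measurableX; exact: measurable_unitI. Qed.

Lemma measurable_unitSq_fst g :
  measurable_fun (unitI R : set (measurableTypeR R)) g ->
  measurable_fun (unitSq R : set (measurableTypeR R * measurableTypeR R))
    (fun z => g z.1).
Proof.
move=> mg; apply: (measurable_comp _ _ mg); first exact: measurable_unitI.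
- by move=> _ [z [zI _] <-].
- by apply: measurable_funTS; exact: measurable_fst.
Qed.

Lemma measurable_unitSq_snd g :
  measurable_fun (unitI R : set (measurableTypeR R)) g ->
  measurable_fun (unitSq R : set (measurableTypeR R * measurableTypeR R))
    (fun z => g z.2).
Proof.
move=> mg; apply: (measurable_comp _ _ mg); first exact: measurable_unitI.
- by move=> _ [z [_ zI] <-].
- by apply: measurable_funTS; exact: measurable_snd.
Qed.

Lemma kernel_integrableM u :
  measurable_fun (unitSq R : set (measurableTypeR R * measurableTypeR R)) u ->
  (forall z, unitSq R z -> `|u z| <= 1) ->
  (leb2 R).-integrable (unitSq R) (EFin \o (fun z => W z * u z)).
Proof.
move=> mu u1; apply: le_integrable WL1; first exact: measurable_unitSq.
- apply/measurable_EFinP; apply: measurable_funM => //.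
  by apply/measurable_EFinP; exact: measurable_int WL1.
- move=> z zI /=; rewrite lee_fin normrM ler_piMr//; exact: u1.
Qed.

(** Fubini is applied on the whole plane to extensions by zero; this brings their slices back to the
    unit interval. *)
Lemma patch_unitSq (K : R * R -> \bar R) x : unitI R x ->
  (fun y => (K \_ (unitSq R)) (x, y)) = (fun y => K (x, y)) \_ (unitI R).
Proof.
move=> xI; apply/funext => y; rewrite !patchE.
have [yI|yI] := boolP (y \in unitI R).
  rewrite (_ : (x, y) \in unitSq R)//; apply/mem_set; split => //.
  exact: set_mem.
by rewrite memNset// => -[_ /mem_set]; exact/negP.
Qed.

Hypothesis Wdeg : {ae leb R, forall x, unitI R x ->
  (\int[leb R]_(y in unitI R) (W (x, y))%:E = 1)%E}.

(** Fubini with the second variable innermost: for almost every [x] the inner integral is [g x]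
    times the degree 1. *)
Lemma integral_kernel_fst g :
  measurable_fun (unitI R : set (measurableTypeR R)) g ->
  (forall x, unitI R x -> `|g x| <= 1) ->
  (\int[leb2 R]_(z in unitSq R) (W z * g z.1)%:E =
   \int[leb R]_(x in unitI R) (g x)%:E)%E.
Proof.
move=> mg g1; have mI := @measurable_unitI R; have mSq := measurable_unitSq.
have iK : (leb2 R).-integrable setT ((fun z => (W z * g z.1)%:E) \_ (unitSq R)).
  apply: (integrable_mkcond _ mSq).1.
  apply: (@kernel_integrableM (fun z => g z.1)).
    exact: measurable_unitSq_fst.
  by move=> z [zI _]; exact: g1.
have iW := (integrable_mkcond _ mSq).1 WL1.
rewrite integral_mkcond -(integral12_prod_meas1 iK) [RHS]integral_mkcond.
apply: ae_eq_integral => //.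
- exact: measurable_fubini_F iK.
- apply/(measurable_restrictT _ mI); exact/measurable_EFinP.
(* Almost every slice of [W] is integrable, which lets [g x] be pulled out of the inner integral. *)
have iWx := ae_integrable1 iW.
apply: (filterS2 _ _ iWx Wdeg) => x {}iWx Wx1 _.
rewrite /fubini_F.
have [xI|xI] := boolP (x \in unitI R); last first.
  rewrite patchE (negbTE xI) integral0_eq// => y _.
  by rewrite patchE memNset// => -[/mem_set xI' _]; move: xI; rewrite xI'.
move/set_mem in xI.
rewrite patch_unitSq// in iWx.
rewrite patchE mem_set//=.
transitivity (\int[leb R]_(y in unitI R) (W (x, y) * g x)%:E)%E.
  rewrite [RHS]integral_mkcond; congr (integral _ _ _).
  exact: (patch_unitSq (fun z => (W z * g z.1)%:E) xI).
under eq_integral do rewrite mulrC EFinM.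
rewrite integralZl//; last exact: (integrable_mkcond _ mI).2.
by rewrite Wx1// mule1.
Qed.

Hypothesis Wsym : {ae leb2 R, forall z,
  unitSq R z -> W (z.1, z.2) = W (z.2, z.1)}.

(** The degree condition concerns integration in the second variable only; exchanging coordinates
    and using the symmetry of [W] reduces this case to [integral_kernel_fst]. *)
Lemma integral_kernel_snd g :
  measurable_fun (unitI R : set (measurableTypeR R)) g ->
  (forall x, unitI R x -> `|g x| <= 1) ->
  (\int[leb2 R]_(z in unitSq R) (W z * g z.2)%:E =
   \int[leb R]_(x in unitI R) (g x)%:E)%E.
Proof.
move=> mg g1; have mI := @measurable_unitI R; have mSq := measurable_unitSq.
have iK : (leb2 R).-integrable setT ((fun z => (W z * g z.1)%:E) \_ (unitSq R)).
  apply: (integrable_mkcond _ mSq).1.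
  apply: (@kernel_integrableM (fun z => g z.1)).
    exact: measurable_unitSq_fst.
  by move=> z [zI _]; exact: g1.
have iL : (leb2 R).-integrable setT ((fun z => (W z * g z.2)%:E) \_ (unitSq R)).
  apply: (integrable_mkcond _ mSq).1.
  apply: (@kernel_integrableM (fun z => g z.2)).
    exact: measurable_unitSq_snd.
  by move=> z [_ zI]; exact: g1.
rewrite -integral_kernel_fst// integral_mkcond [RHS]integral_mkcond.
rewrite -(integral_swap iK).
apply: ae_eq_integral => //.
- exact: measurable_int iL.
- exact: measurable_int (integrable_swap iK).
apply: (@filterS _ _ (ae_filter_ringOfSetsType _) _ _ _ Wsym) => -[x y] /=.
move=> Wxy _; rewrite !patchE.
have [zI|zI] := boolP ((x, y) \in unitSq R).
  rewrite Wxy; last exact: set_mem.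
  by rewrite mem_set//; have [] := set_mem zI.
by rewrite memNset// => -[yI xI]; move/negP: zI; apply; apply/mem_set.
Qed.

Lemma G_diff f : F2 f ->
  G W ord0 f - G W ord_max f =
  \int[leb R]_(x in unitI R) f ord0 x - \int[leb R]_(x in unitI R) f ord_max x.
Proof.
move=> Ff; have mSq := measurable_unitSq.
have [mf f01 f1] := Ff.
have iG r :
    (leb2 R).-integrable (unitSq R) (EFin \o (fun z => W z * f r z.1 * f r z.2)).
  rewrite (_ : (fun _ => _) = (fun z => W z * (f r z.1 * f r z.2))); last first.
    by apply/funext => z; rewrite mulrA.
  apply: kernel_integrableM => [|z [z1 z2]].
    by apply: measurable_funM;
      [exact: measurable_unitSq_fst (mf r)|exact: measurable_unitSq_snd (mf r)].
  by rewrite normrM mulr_ile1//; exact: F2_norm_le1.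
have ifst :
    (leb2 R).-integrable (unitSq R) (EFin \o (fun z => W z * f ord0 z.1)).
  apply: kernel_integrableM => [|z [z1 z2]].
    exact: measurable_unitSq_fst (mf ord0).
  exact: F2_norm_le1.
have isnd :
    (leb2 R).-integrable (unitSq R) (EFin \o (fun z => W z * f ord_max z.2)).
  apply: kernel_integrableM => [|z [z1 z2]].
    exact: measurable_unitSq_snd (mf ord_max).
  exact: F2_norm_le1.
have <- : \int[leb2 R]_(z in unitSq R) (W z * f ord0 z.1) =
    \int[leb R]_(x in unitI R) f ord0 x.
  by congr fine; apply: (@integral_kernel_fst (f ord0)) => [|x xI];
    [exact: mf|exact: F2_norm_le1].
have <- : \int[leb2 R]_(z in unitSq R) (W z * f ord_max z.2) =
    \int[leb R]_(x in unitI R) f ord_max x.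
  by congr fine; apply: (@integral_kernel_snd (f ord_max)) => [|x xI];
    [exact: mf|exact: F2_norm_le1].
rewrite /G -!RintegralB//; apply: eq_Rintegral => z /set_mem[z1 z2].
have := f1 _ z1; have := f1 _ z2; rewrite !sum_ord2.
(* After eliminating colour 2 at [z.2] and colour 1 at [z.1], both sides equal
   [W z * (f ord0 z.2 - f ord_max z.1)]. *)
move=> /(canRL (addKr _)) -> /(canRL (addrK _)) ->.
ring.
Qed.

End kernel.

(** * Both variational problems reduced to Gibbs' inequality *)

Section proposition.
Context (R : realType) (W : R * R -> R).
Implicit Types (f : 'I_2 -> R -> R) (h q : 'I_2 -> R).
Hypothesis hW : kernelW2 W.
Hypothesis hdeg : {ae leb R, forall x, unitI R x ->
  (\int[leb R]_(y in unitI R) (W (x, y))%:E = 1)%E}.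

Lemma sum_signed_G t f : F2 f ->
  \sum_(r < 2) vec2 t (- t) r * G W r f = field_term (vec2 t (- t)) f.
Proof.
move=> Ff; have [WL1 Wsym] := hW; rewrite /field_term !sum_ord2 /vec2 eqxx/=.
by rewrite !mulNr -!mulrBr (G_diff WL1 hdeg Wsym Ff).
Qed.

Lemma field_term_pm1_cst q :
  field_term (vec2 1 (- 1)) (fun r _ => q r) = q ord0 - q ord_max.
Proof.
by rewrite /field_term sum_ord2 /vec2 eqxx/= !Rintegral_unitI_cst mul1r mulN1r. Qed.

Lemma prob_vec_vec2 (a b : R) :
  0 < a -> 0 < b -> a + b = 1 -> prob_vec (vec2 a b).
Proof. by move=> a0 b0 ab; split; [exact: forall_ord2|rewrite sum_ord2]. Qed.

(** The interaction acts as an extra field [vec2 t (- t)]. Once the total field is [ln q] up to a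
    constant, maximising the objective is minimising the divergence from [q]. *)
Lemma objective_gibbs h t q C f :
  (forall r, h r + vec2 t (- t) r = ln (q r) + C) ->
  F2 f ->
  objective W h (vec2 t (- t)) f =
  C - (entropy f - field_term (fun r => ln (q r)) f).
Proof.
move=> hq Ff; rewrite /objective sum_signed_G// [X in X - _]addrC -field_termD.
under [X in field_term X]eq_fun do rewrite hq.
rewrite field_termD field_term_cst//; ring.
Qed.

Lemma objective_le h t q C f :
  (forall r, h r + vec2 t (- t) r = ln (q r) + C) ->
  prob_vec q -> F2 f ->
  objective W h (vec2 t (- t)) f <=
  objective W h (vec2 t (- t)) (fun r _ => q r).
Proof.
move=> hq qP Ff; rewrite !(objective_gibbs hq)//; last exact: F2_cst.
by rewrite entropy_cst subrr lerD2l lerN2 subr_ge0 gibbs_le.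
Qed.

Lemma sup_value_gibbs h t q C :
  (forall r, h r + vec2 t (- t) r = ln (q r) + C) ->
  prob_vec q ->
  sup_value W h (vec2 t (- t)) =
  (objective W h (vec2 t (- t)) (fun r _ => q r) - ln 2)%:E.
Proof.
move=> hq qP; rewrite /sup_value EFinB; congr (_ - _)%E.
apply/eqP; rewrite eq_le; apply/andP; split.
  by apply: ge_ereal_sup => _ [f Ff <-]; rewrite lee_fin (objective_le hq).
by apply: ereal_sup_ubound; exists (fun r _ => q r) => //; exact: F2_cst.
Qed.

Lemma maximizer_gibbs h t q C f :
  (forall r, h r + vec2 t (- t) r = ln (q r) + C) ->
  prob_vec q -> is_maximizer W h (vec2 t (- t)) f -> aeeq f (fun r _ => q r).
Proof.
move=> hq qP [Ff]; rewrite (sup_value_gibbs hq qP) => -[] /addIr.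
rewrite !(objective_gibbs hq)//; last exact: F2_cst.
rewrite entropy_cst subrr subr0 => fq; apply: gibbs_eq => //; lra.
Qed.

(** The constraint fixes both colour masses, so every field term is constant on the feasible set;
    Gibbs' inequality then shows that the constant [q] has least entropy. *)
Lemma rateI_gibbs h q : prob_vec q ->
  rateI W h (vec2 1 (- 1)) (q ord0 - q ord_max) =
  (\sum_(r < 2) q r * (ln (q r) - h r) + ln (\sum_(r < 2) expR (h r)))%:E.
Proof.
move=> qP; rewrite /rateI EFinD; congr (_ + _)%E.
have Fq := F2_cst qP.
have -> : \sum_(r < 2) q r * (ln (q r) - h r) =
    entropy (fun r _ => q r) - field_term h (fun r _ => q r).
  rewrite entropy_cst /field_term -sumrB; apply: eq_bigr => r _.
  by rewrite Rintegral_unitI_cst; ring.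
apply/eqP; rewrite eq_le; apply/andP; split.
  apply: ereal_inf_lbound; exists (fun r _ => q r) => //; split => //.
  by rewrite sum_signed_G// field_term_pm1_cst.
apply: le_ereal_inf_tmp => _ [f [Ff fq] <-]; rewrite sum_signed_G// in fq.
(* The masses of [f] have the same difference as those of [q], by the constraint, and the same sum
   1. *)
have mean r : \int[leb R]_(x in unitI R) f r x = q r.
  have := F2_sum_Rintegral Ff; move: fq; have := qP.2.
  rewrite /field_term !sum_ord2 /vec2 eqxx/= => q1 fq f1.
  by move: r; apply: forall_ord2; lra.
have ft g : field_term g f = field_term g (fun r _ => q r).
  by apply: eq_bigr => r _; rewrite mean Rintegral_unitI_cst.
by rewrite lee_fin ft lerD2r entropy_cst -ft gibbs_le.
Qed.

End proposition.

(** * Explicit choices of [q] for the two parts *)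

Theorem proposition2p16 (R : realType) (W : R * R -> R) (p theta : R)
    (h : 'I_2 -> R)
    (hW : kernelW2 W)
    (hdeg : {ae leb R, forall x, unitI R x ->
       (\int[leb R]_(y in unitI R) (W (x, y))%:E = 1)%E})
    (hpos : {ae leb2 R, forall z, unitSq R z -> 0 < W z})
    (hp : 0 < p < 1)
    (hh : forall r : 'I_2,
       vec2 p (1 - p) r = expR (h r) / \sum_(s < 2) expR (h s)) :
  let alpha := vec2 theta (- theta) in
  let D := 1 - p + p * expR (2 * theta) in
  let fstar : 'I_2 -> R -> R :=
    fun r _ => vec2 (p * expR (2 * theta) / D) ((1 - p) / D) r in
  [/\ is_maximizer W h alpha fstar,
      forall f, is_maximizer W h alpha f -> aeeq f fstar &
      forall f g, is_maximizer W h alpha f -> is_maximizer W h alpha g ->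
        aeeq f g] /\
  forall y : R, -1 < y < 1 ->
    rateI W h (vec2 1 (-1)) y =
    ((y + 1) / 2 * ln ((y + 1) / (2 * p)) +
     (1 - y) / 2 * ln ((1 - y) / (2 * (1 - p))))%:E.
Proof.
move=> alpha D fstar; have /andP[p0 p1] := hp.
have p1' : 0 < 1 - p by rewrite subr_gt0.
pose Z := \sum_(s < 2) expR (h s).
have Z0 : 0 < Z by rewrite /Z sum_ord2 addr_gt0 ?expR_gt0.
have lnh r : h r = ln (vec2 p (1 - p) r) + ln Z.
  by rewrite hh ln_div ?posrE ?expR_gt0// expRK subrK.
have e0 : 0 < expR (2 * theta) by exact: expR_gt0.
have D0 : 0 < D by rewrite addr_gt0 ?mulr_gt0.
split.
  pose q : 'I_2 -> R := vec2 (p * expR (2 * theta) / D) ((1 - p) / D).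
  have qP : prob_vec q.
    apply: prob_vec_vec2; rewrite ?divr_gt0 ?mulr_gt0//.
    by rewrite -mulrDl addrC divff// gt_eqF.
  (* The fields [theta] and [- theta] differ from [2 * theta] and 0, the tilts in [q], by the same
     shift [- theta]; [ln Z] and [ln D] undo the normalisations. *)
  have hq : forall r, h r + alpha r = ln (q r) + (ln Z + ln D - theta).
    apply: forall_ord2; rewrite lnh /q /alpha /vec2 ?eqxx/=;
      rewrite ln_div ?posrE ?mulr_gt0//.
      by rewrite lnM ?posrE// expRK; ring.
    ring.
  have max f : is_maximizer W h alpha f -> aeeq f fstar.
    exact: (maximizer_gibbs hW hdeg hq qP).
  split.
  - by split; [exact: F2_cst|rewrite (sup_value_gibbs hW hdeg hq qP)].
  - exact: max.
  - move=> f g /max fq /max gq.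
    apply: (@filterS2 _ _ (ae_filter_ringOfSetsType _) _ _ _ _ fq gq).
    by move=> x fx gx xI r; rewrite fx ?gx.
move=> y /andP[y0 y1].
(* The only vector with sum 1 and difference [y]; it is positive since [-1 < y < 1]. *)
pose q : 'I_2 -> R := vec2 ((y + 1) / 2) ((1 - y) / 2).
have qP : prob_vec q by apply: prob_vec_vec2; [lra|lra|field].
have yE : y = q ord0 - q ord_max by rewrite /q /vec2 eqxx/=; field.
rewrite {1}yE (rateI_gibbs hW hdeg h qP) -/Z sum_ord2 !lnh /q /vec2 eqxx/=.
have ln2M (a b : R) : 0 < a -> 0 < b -> ln (a / (2 * b)) = ln (a / 2) - ln b.
  by move=> a0 b0; rewrite invfM mulrA [LHS]ln_div// ?posrE ?divr_gt0//.
rewrite !ln2M//; [congr EFin|lra..].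
(* The [ln Z] terms cancel because the weights sum to 1. *)
by field.
Qed.
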